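(* Let $R$ be a commutative Noetherian ring of prime characteristic $p$ and let $\mathfrak{a}$ be a proper ideal of $R$. Let $m_0$ be a non-negative integer such that either (i) there exists a $p^{m_0}$-weak test element $c'$ for $R$, or (ii) $\left((\mathfrak{a}^{[p^n]})^F\right)^{[p^{m_0}]} = (\mathfrak{a}^{[p^n]})^{[p^{m_0}]}$ for all integers $n \geq 0$. Then, for $r \in R$, we have $r \in \mathfrak{a}^*$ if and only if there exists $c \in R^{\circ}$ such that $c r^{p^n} \in (\mathfrak{a}^{[p^n]})^F$ for all $n \gg 0$.
   Context: For an ideal $\mathfrak{b}$ of $R$ and an integer $n \geq 0$, the $n$-th Frobenius power $\mathfrak{b}^{[p^n]}$ is the ideal generated by all $p^n$-th powers of elements of $\mathfrak{b}$. $R^{\circ}$ denotes the complement in $R$ of the union of the minimal prime ideals of $R$. The tight closure $\mathfrak{b}^*$ is the set of $r \in R$ for which there exists $c \in R^{\circ}$ with $c r^{p^n} \in \mathfrak{b}^{[p^n]}$ for all $n \gg 0$. The Frobenius closure is $\mathfrak{b}^F = \{ r \in R : r^{p^n} \in \mathfrak{b}^{[p^n]} \text{ for some integer } n \geq 0\}$. A $p^{m_0}$-weak test element for $R$ is an element $c' \in R^{\circ}$ such that, for every ideal $\mathfrak{b}$ of $R$ and every $r \in R$, we have $r \in \mathfrak{b}^*$ if and only if $c' r^{p^n} \in \mathfrak{b}^{[p^n]}$ for all $n \geq m_0$. *)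

(* Defs.v *)
From HB Require Import structures.
From mathcomp Require Import all_boot all_order all_algebra.
From mathcomp Require Import all_classical.

Set Implicit Arguments.
Unset Strict Implicit.
Unset Printing Implicit Defensive.

Import GRing.Theory.
Local Open Scope classical_set_scope.
Local Open Scope ring_scope.

(* Subsets of R are classical sets, and [in I] is the associated boolean      *)
(* collective predicate. An ideal is a submodule of the regular module R^o;   *)
(* R itself is allowed. The library's idealr_closed describes PROPER ideals   *)
(* only, see is_proper_idealP below.                                          *)
Definition is_ideal (R : comNzRingType) (I : set R) : Prop :=
  submod_closed ([in I] : {pred R^o}).

Definition is_proper_ideal (R : comNzRingType) (I : set R) : Prop :=
  idealr_closed [in I].

(* Primality of P includes properness. *)
Definition is_prime_ideal (R : comNzRingType) (P : set R) : Prop :=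
  is_proper_ideal P /\ prime_idealr_closed [in P].

Definition is_minimal_prime (R : comNzRingType) (P : set R) : Prop :=
  is_prime_ideal P /\ forall Q : set R, is_prime_ideal Q -> Q `<=` P -> Q = P.

Definition ideal_gen (R : comNzRingType) (S : set R) : set R :=
  smallest (@is_ideal R) S.

Definition noetherian (R : comNzRingType) : Prop :=
  forall I : set R, is_ideal I -> exists s : seq R, I = ideal_gen [set` s].

(* $R^\circ$ *)
Definition Rcirc (R : comNzRingType) : set R :=
  ~` \bigcup_(P in @is_minimal_prime R) P.
Arguments Rcirc : clear implicits.

(* Below, p stands for the characteristic of R; frob_power p n b is           *)
(* $b^{[p^n]}$.                                                               *)
Definition frob_power (R : comNzRingType) (p n : nat) (b : set R) : set R :=
  ideal_gen [set x ^+ (p ^ n)%N | x in b].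

Definition tight_closure (R : comNzRingType) (p : nat) (b : set R) : set R :=
  [set r | exists2 c : R, Rcirc R c &
     \forall n \near \oo, frob_power p n b (c * r ^+ (p ^ n)%N)].

Definition frob_closure (R : comNzRingType) (p : nat) (b : set R) : set R :=
  [set r | exists n : nat, frob_power p n b (r ^+ (p ^ n)%N)].

Definition weak_test_element (R : comNzRingType) (p m0 : nat) (c' : R) : Prop :=
  Rcirc R c' /\
  forall b : set R, is_ideal b -> forall r : R,
    tight_closure p b r <->
    (forall n : nat, (m0 <= n)%N -> frob_power p n b (c' * r ^+ (p ^ n)%N)).

Lemma is_idealP (R : comNzRingType) (I : set R) :
  is_ideal I <-> [/\ I 0, forall x y, I x -> I y -> I (x + y)
                   & forall a x, I x -> I (a * x)].
Proof.
split=> [[/set_mem I0 Ilin]|[I0 ID IM]].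
  split=> // [x y Ix Iy|a x Ix].
    by have /set_mem := Ilin 1 x y (mem_set Ix) (mem_set Iy); rewrite scale1r.
  by have /set_mem := Ilin a x 0 (mem_set Ix) (mem_set I0); rewrite addr0.
split=> [|a x y /set_mem Ix /set_mem Iy]; first exact: mem_set.
by apply: mem_set; apply: ID => //; apply: IM.
Qed.

Lemma is_proper_idealP (R : comNzRingType) (I : set R) :
  is_proper_ideal I <-> is_ideal I /\ ~ I 1.
Proof.
split=> [[I0 /negP I1 Ilin]|[[I0 Ilin] I1]].
  by split; [split | move=> /mem_set].
by split=> //; apply/negP => /set_mem.
Qed.

Lemma ideal_gen_ideal (R : comNzRingType) (S : set R) : is_ideal (ideal_gen S).
Proof.
apply/is_idealP; split=> [I [/is_idealP[]]|x y Sx Sy I II|a x Sx I II] //.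
  have [/is_idealP[_ ID _] _] := II.
  by apply: ID; [apply: Sx|apply: Sy].
by have [/is_idealP[_ _ IM] _] := II; apply: IM; apply: Sx.
Qed.

(* Main.v *)
Require Import Defs.
From HB Require Import structures.
From mathcomp Require Import all_boot all_order all_algebra.
From mathcomp Require Import all_classical.

Set Implicit Arguments.
Unset Strict Implicit.
Unset Printing Implicit Defensive.

Import GRing.Theory.
Local Open Scope classical_set_scope.
Local Open Scope ring_scope.

(** Every ideal is contained in its Frobenius closure, so the multiplier [c]
    that witnesses tight closure also witnesses the weaker membership.  The
    content is the converse, which undoes all the Frobenius closures
    [(a^[p^n])^F] at the cost of a bounded Frobenius twist: either hypothesis
    on [m0] provides one element [d] of the complement of the minimal primes,
    independent of [n], such that [d s^(p^m0)] lies in [(a^[p^n])^[p^m0]] for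
    every [s] in [(a^[p^n])^F].  A weak test element serves as [d] because
    Frobenius closure sits inside tight closure
    ([frob_closure_sub_tight_closure]); under the equality of ideals [d = 1]
    does.

    Apply this to [s = c r^(p^n)].  As [(a^[p^n])^[p^m0]] is contained in
    [a^[p^(n + m0)]] ([frob_power_frob_power]), it gives
    [(d c^(p^m0)) r^(p^(n + m0))] in [a^[p^(n + m0)]] for all large [n]
    ([tight_closure_of_multiplier]).  The new multiplier [d c^(p^m0)] does not
    depend on [n] and avoids every minimal prime because [d] and [c] do. *)

Lemma sub_ideal_gen (R : comNzRingType) (S : set R) : S `<=` ideal_gen S.
Proof. exact: sub_gen_smallest. Qed.

Lemma ideal_gen_min (R : comNzRingType) (S I : set R) :
  is_ideal I -> S `<=` I -> ideal_gen S `<=` I.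
Proof. exact: smallest_sub. Qed.

Lemma Rcirc1 (R : comNzRingType) : Rcirc R 1.
Proof. by move=> [P [[/is_proper_idealP[_ P1] _] _] /P1]. Qed.

Lemma RcircM (R : comNzRingType) (c d : R) :
  Rcirc R c -> Rcirc R d -> Rcirc R (c * d).
Proof.
move=> cR dR [P Pmin Pcd]; have [[_ Pprime] _] := Pmin.
by have /orP[/set_mem Pc|/set_mem Pd] := Pprime _ _ (mem_set Pcd);
  [apply: cR|apply: dR]; exists P.
Qed.

Lemma RcircX (R : comNzRingType) (c : R) n : Rcirc R c -> Rcirc R (c ^+ n).
Proof.
move=> cR; elim: n => [|n IHn]; first by rewrite expr0; apply: Rcirc1.
by rewrite exprS; apply: RcircM.
Qed.

Section FrobeniusPowers.

Context (R : comNzRingType) (p : nat) (hp : p \in [pchar R]).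
Implicit Types (a b I : set R) (m n : nat) (r s x y : R).

Lemma expr_frob_power n b x : b x -> frob_power p n b (x ^+ (p ^ n)).
Proof. by move=> bx; apply: sub_ideal_gen; exists x. Qed.

Lemma sub_frob_closure b : b `<=` frob_closure p b.
Proof. by move=> x bx; exists 0; apply: expr_frob_power. Qed.

(** In characteristic [p] the map [x |-> x^(p^m)] is a ring endomorphism, and
    preimages of ideals under ring morphisms are ideals. *)
Lemma frob_preimage_ideal m I :
  is_ideal I -> is_ideal [set x | I (x ^+ (p ^ m))].
Proof.
have p_gt0 : (0 < p)%N := prime_gt0 (pcharf_prime hp).
have pm_pchar : [pchar R].-nat (p ^ m)%N.
  by rewrite (eq_pnat _ (pcharf_eq hp)) pnatX pnat_id ?orbT ?(pcharf_prime hp).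
move=> /is_idealP[I0 ID IM]; apply/is_idealP; split=> [|x y Ix Iy|c x Ix] /=.
- by rewrite expr0n expn_eq0 eqn0Ngt p_gt0.
- by rewrite exprDn_pchar //; apply: ID.
- by rewrite exprMn; apply: IM.
Qed.

(** The elements whose [p^m]-th power lies in [a^[p^(n + m)]] form an ideal,
    so it suffices to look at the generators [x^(p^n)] of [a^[p^n]]. *)
Lemma frob_power_expr m n a x :
  frob_power p n a x -> frob_power p (n + m) a (x ^+ (p ^ m)).
Proof.
apply: (ideal_gen_min (I := [set y | frob_power p (n + m) a (y ^+ (p ^ m))])).
  exact/frob_preimage_ideal/ideal_gen_ideal.
by move=> _ [y ay <-] /=; rewrite -exprM -expnD; apply: expr_frob_power.
Qed.

Lemma frob_power_frob_power m n a :
  frob_power p m (frob_power p n a) `<=` frob_power p (n + m) a.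
Proof.
apply: ideal_gen_min; first exact: ideal_gen_ideal.
by move=> _ [x ax <-]; apply: frob_power_expr.
Qed.

(** Once [r^(p^k)] lies in [b^[p^k]], all its further Frobenius powers lie in
    the corresponding Frobenius powers of [b], so [1] is a multiplier. *)
Lemma frob_closure_sub_tight_closure b : frob_closure p b `<=` tight_closure p b.
Proof.
move=> r [k rk]; exists 1; first exact: Rcirc1.
exists k => // n /= lekn; rewrite mul1r -(subnKC lekn) expnD exprM.
exact: frob_power_expr.
Qed.

(** Since the twist by [p^m] is the same for all [n], it sends [c r^(p^n)] to
    [c^(p^m) r^(p^(n + m))], again a fixed multiple of a Frobenius power of
    [r]; hence [d c^(p^m)] is a multiplier for [r]. *)
Lemma tight_closure_of_multiplier a m (d c r : R) :
    Rcirc R d -> Rcirc R c ->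
    (forall n s, frob_closure p (frob_power p n a) s ->
       frob_power p m (frob_power p n a) (d * s ^+ (p ^ m))) ->
    (\forall n \near \oo,
       frob_closure p (frob_power p n a) (c * r ^+ (p ^ n))) ->
  tight_closure p a r.
Proof.
move=> dR cR dF [N _ cF]; exists (d * c ^+ (p ^ m)).
  exact/RcircM/RcircX.
exists (N + m)%N => // k /= leNmk.
have lemk : (m <= k)%N := leq_trans (leq_addl N m) leNmk.
have leNk : (N <= k - m)%N by rewrite leq_subRL // addnC.
have := frob_power_frob_power (dF _ _ (cF _ leNk)).
by rewrite exprMn -exprM -expnD subnK // mulrA.
Qed.

End FrobeniusPowers.

Theorem lemma0p1 (R : comNzRingType) (p : nat) (hp : p \in [pchar R])
    (hR : noetherian R) (a : set R) (ha : is_proper_ideal a) (m0 : nat)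
    (hm0 : (exists c' : R, weak_test_element p m0 c') \/
           (forall n : nat,
              frob_power p m0 (frob_closure p (frob_power p n a)) =
              frob_power p m0 (frob_power p n a)))
    (r : R) :
  tight_closure p a r <->
  exists2 c : R, Rcirc R c &
    \forall n \near \oo,
      frob_closure p (frob_power p n a) (c * r ^+ (p ^ n)%N).
Proof.
split=> [[c cR [N _ ca]]|[c cR cF]].
  by exists c => //; exists N => // n Nn; apply: sub_frob_closure; apply: ca.
case: hm0 => [[c' [c'R c'test]]|hF].
- apply: (tight_closure_of_multiplier (m := m0) hp c'R cR _ cF) => n s sF.
  have an_ideal : is_ideal (frob_power p n a) by apply: ideal_gen_ideal.
  have [c'F _] := c'test _ an_ideal s.
  exact: c'F (frob_closure_sub_tight_closure hp sF) m0 (leqnn m0).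
- apply: (tight_closure_of_multiplier (m := m0) hp (@Rcirc1 R) cR _ cF) => n s sF.
  by rewrite mul1r -hF; apply: expr_frob_power.
Qed.
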